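(* Let $K$ be a convex body in $\mathbb{R}^n$. Let $c\colon K\times K\to\mathbb{R}$ be a continuous function satisfying the martingale triangle inequality and vanishing on the diagonal. Let $\mathcal{B}_1$ denote the set of functions $f\in\mathcal{C}(K)$ such that for all $x_1,\dotsc,x_{n+1}\in K$ and all non-negative $\lambda_1,\dotsc,\lambda_{n+1}$ that sum up to one there is $$f\Big(\sum_{i=1}^{n+1}\lambda_ix_i\Big)- \sum_{i=1}^{n+1}\lambda_i f(x_i)\leq\sum_{i=1}^{n+1}\lambda_ic\Big(\sum_{j=1}^{n+1}\lambda_jx_j,x_i\Big).$$ Let $\mathcal{B}_2$ denote the set of functions $g\in\mathcal{C}(K\cup K)$ on the disjoint union of two copies of $K$ such that for all $x_1,\dotsc,x_{n+1}\in K$ and all non-negative $\lambda_1,\dotsc,\lambda_{n+1}$ that sum up to one there is $$g_1\Big(\sum_{i=1}^{n+1}\lambda_ix_i\Big)- \sum_{i=1}^{n+1}\lambda_i g_2(x_i)\leq\sum_{i=1}^{n+1}\lambda_ic\Big(\sum_{j=1}^{n+1}\lambda_jx_j,x_i\Big).$$ Then, for any Borel probability measures $\mu,\nu$ on $K$ in convex order there is $$\sup\Big\{\int_K f \,d(\mu-\nu)\mid f\in \mathcal{B}_1\Big\}=\sup\Big\{\int_K g_1 \,d\mu-\int_K g_2 \,d\nu\mid g\in \mathcal{B}_2\Big\}.$$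
   Context: A convex body is a convex, compact set with non-empty interior. $\mathcal{C}(\cdot)$ denotes the space of bounded continuous real functions. For a function $g$ on the disjoint union of two copies of $K$, $g_1$ and $g_2$ denote its restrictions to the first and second copy, respectively. A function $c\colon K\times K\to\mathbb{R}$ satisfies the martingale triangle inequality if for all $x,x_1,\dotsc,x_{n+1}\in K$ and all non-negative $\lambda_1,\dotsc,\lambda_{n+1}$ that sum up to one $$\sum_{i=1}^{n+1}\lambda_i c(x,x_i)-c\Big(x,\sum_{i=1}^{n+1}\lambda_ix_i\Big)\leq \sum_{i=1}^{n+1} \lambda_i c\Big( \sum_{j=1}^{n+1}\lambda_j x_j,x_i\Big).$$ Vanishing on the diagonal means $c(x,x)=0$ for all $x\in K$. Borel probability measures $\mu,\nu$ on $K$ are in convex order if $\int_K g\,d\mu\le\int_K g\,d\nu$ for all continuous convex $g\colon K\to\mathbb{R}$. *)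

(* Defs.v *)
From HB Require Import structures.
From mathcomp Require Export all_boot all_order all_algebra.
From mathcomp Require Export all_classical all_reals all_analysis.

Set Implicit Arguments.
Unset Strict Implicit.
Unset Printing Implicit Defensive.

Import Order.TTheory GRing.Theory Num.Theory.
Export numFieldNormedType.Exports.

Local Open Scope classical_set_scope.
Local Open Scope ring_scope.

(* A function on a subset A of an ambient space is a total function on that
   space; only its values on A are constrained or used. *)

Definition bounded_continuous (R : realType) (T : topologicalType)
    (A : set T) : set (T -> R) :=
  [set f | {within A, continuous f} /\ [bounded f x | x in A]].

(* The sup norm carried by 'rV[R]_n induces the usual topology. *)
Definition borel_rV (R : realType) (n : nat) :=
  g_sigma_algebraType (@open 'rV[R]_n).

Definition disjoint_double (T : Type) (A : set T) : set {_ : bool & T} :=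
  [set p | A (projT2 p)].

Definition fst_copy (T U : Type) (g : {_ : bool & T} -> U) (x : T) : U :=
  g (existT (fun=> T) false x).

Definition snd_copy (T U : Type) (g : {_ : bool & T} -> U) (x : T) : U :=
  g (existT (fun=> T) true x).

Section Transport.
Context {R : realType} {n : nat}.
Implicit Types (K : set 'rV[R]_n) (c : 'rV[R]_n -> 'rV[R]_n -> R).

Definition convex_body K : Prop :=
  [/\ convex_set (K : set (convex_lmodType 'rV[R]_n)),
      compact K & K° !=set0].

Definition convex_weights (l : 'I_n.+1 -> R) : Prop :=
  (forall i, 0 <= l i) /\ \sum_i l i = 1.

Definition barycenter (l : 'I_n.+1 -> R) (x : 'I_n.+1 -> 'rV[R]_n) :
    'rV[R]_n :=
  \sum_i l i *: x i.

Definition martingale_triangle K c : Prop :=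
  forall (x : 'rV[R]_n) (y : 'I_n.+1 -> 'rV[R]_n) (l : 'I_n.+1 -> R),
    K x -> (forall i, K (y i)) -> convex_weights l ->
    \sum_i l i * c x (y i) - c x (barycenter l y)
      <= \sum_i l i * c (barycenter l y) (y i).

Definition B1 K c : set ('rV[R]_n -> R) :=
  [set f | bounded_continuous K f /\
    forall (x : 'I_n.+1 -> 'rV[R]_n) (l : 'I_n.+1 -> R),
      (forall i, K (x i)) -> convex_weights l ->
      f (barycenter l x) - \sum_i l i * f (x i)
        <= \sum_i l i * c (barycenter l x) (x i)].

Definition B2 K c : set ({_ : bool & 'rV[R]_n} -> R) :=
  [set g | bounded_continuous (disjoint_double K) g /\
    forall (x : 'I_n.+1 -> 'rV[R]_n) (l : 'I_n.+1 -> R),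
      (forall i, K (x i)) -> convex_weights l ->
      fst_copy g (barycenter l x) - \sum_i l i * snd_copy g (x i)
        <= \sum_i l i * c (barycenter l x) (x i)].

Definition convex_order K (mu nu : probability (borel_rV R n) R) : Prop :=
  forall g : 'rV[R]_n -> R,
    {within K, continuous g} ->
    convex_function (K : set (convex_lmodType 'rV[R]_n)) g ->
    \int[mu]_(x in K) g x <= \int[nu]_(x in K) g x.

End Transport.

(* Main.v *)
Require Import Defs.
From mathcomp Require Import ring lra.

(* Any [f] in B1 gives the pair [(f, f)] in B2.  Conversely, given [g] in B2 and
   [e > 0], it suffices to find [f] in B1 with [g_1 - e <= f <= g_2] on [K].
   The martingale triangle inequality says precisely that [a - c z] is in B1 for
   every affine [a] and every [z] in [K], and B1 is stable under maxima.  For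
   fixed [z], the condition defining B2 says that the convex envelope of [g_2 +
   c z] at [z] is at least [g_1 z]; Hahn-Banach then yields an affine [a <= g_2
   + c z] with [a z >= g_1 z - e], and by compactness the maximum of finitely
   many of the functions [a - c z] is the required [f].  Working with finite
   maxima avoids the convex envelope itself, which need not be continuous on
   [K]. *)

Set Implicit Arguments.
Unset Strict Implicit.
Unset Printing Implicit Defensive.

Import Order.TTheory GRing.Theory Num.Theory.

Local Open Scope classical_set_scope.
Local Open Scope ring_scope.

(** * Carathéodory's theorem with a cost *)

(** The rows [(x i, 1)] lie in a space of dimension [n + 1], so more than [n + 1] of them are
    linearly dependent; the appended coordinate yields [\sum_i d i = 0]. *)
Lemma affine_dependence (F : fieldType) (n N : nat) (x : 'I_N -> 'rV[F]_n) :
  (n.+1 < N)%N ->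
  exists d : 'I_N -> F,
    [/\ \sum_i d i = 0, \sum_i d i *: x i = 0 & exists i, d i != 0].
Proof.
move=> ltnN; pose A : 'M[F]_(N, n + 1) :=
  row_mx (\matrix_i x i) (const_mx 1).
have /rowV0Pn[d /sub_kermxP dA /rV0Pn d_neq0] : kermx A != 0.
  rewrite -mxrank_eq0 mxrank_ker subn_eq0 -ltnNge.
  by rewrite (leq_ltn_trans (rank_leq_col A))// addn1.
move: dA; rewrite mul_mx_row -row_mx0 => /eq_row_mx[dx d1].
exists (d 0); split => //.
- have /rowP/(_ 0) := d1; rewrite !mxE => {2}<-.
  by apply: eq_bigr => i _; rewrite mxE mulr1.
- by rewrite -[RHS]dx mulmx_sum_row; under [RHS]eq_bigr do rewrite rowK.
Qed.

(** The weights move along an affine dependence that does not raise the cost, until the first of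
    them vanishes. *)
Lemma caratheodory_step (R : realFieldType) (n N : nat) (l : 'I_N -> R)
    (x : 'I_N -> 'rV[R]_n) (k : 'I_N -> R) :
  (n.+1 < N)%N -> (forall i, 0 <= l i) ->
  exists l' : 'I_N -> R,
    [/\ forall i, 0 <= l' i, \sum_i l' i = \sum_i l i,
        \sum_i l' i *: x i = \sum_i l i *: x i,
        \sum_i l' i * k i <= \sum_i l i * k i & exists i, l' i = 0].
Proof.
move=> ltnN l_ge0.
(* If [d] raises the cost, [- d] lowers it. Either one has a negative entry, being nonzero with sum
   zero. *)
have [d [d1 dx dk [i0 di0]]] : exists d : 'I_N -> R,
    [/\ \sum_i d i = 0, \sum_i d i *: x i = 0, \sum_i d i * k i <= 0
      & exists i, d i < 0].
  have [d [d1 dx [i di]]] := affine_dependence x ltnN.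
  have neg (e : 'I_N -> R) : \sum_i e i = 0 -> e i != 0 -> exists j, e j < 0.
    move=> e1 ei; apply/not_existsP => e_ge0.
    have {}e_ge0 j : 0 <= e j by rewrite leNgt; apply/negP/e_ge0.
    by move: ei; rewrite (psumr_eq0P _ e1) ?eqxx.
  have [dk|/ltW dk] := leP (\sum_i d i * k i) 0.
    by exists d; split => //; exact: neg di.
  exists (fun i => - d i); split.
  - by rewrite sumrN d1 oppr0.
  - by under eq_bigr do rewrite scaleNr; rewrite sumrN dx oppr0.
  - by under eq_bigr do rewrite mulNr; rewrite sumrN oppr_le0.
  - by apply: neg => /=; [rewrite sumrN d1 oppr0|rewrite oppr_eq0].
(* The least ratio [l i / - d i] over the negative [d i] is the longest step that keeps all weights
   non-negative, and it brings the weight of the minimiser to zero. *)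
have [i di /= i_min] := @Order.TotalTheory.arg_minP _ R _ i0
  (fun i => d i < 0) (fun i => l i / - d i) di0.
pose t := l i / - d i.
have t_ge0 : 0 <= t by rewrite divr_ge0// oppr_ge0 ltW.
exists (fun j => l j + t * d j); split.
- move=> j; have [dj|dj] := leP 0 (d j); first last.
    by have := i_min _ dj; rewrite ler_pdivlMr ?oppr_gt0// -/t; lra.
  by apply: addr_ge0 => //; exact: mulr_ge0.
- by rewrite big_split/= -mulr_sumr d1 mulr0 addr0.
- under eq_bigr do rewrite scalerDl -scalerA.
  by rewrite big_split/= -scaler_sumr dx scaler0 addr0.
- under eq_bigr do rewrite mulrDl -mulrA.
  by rewrite big_split/= -mulr_sumr gerDl mulr_ge0_le0.
- exists i; rewrite /t; field; lra.
Qed.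

(** Induction on the surplus [m]: each step discards a point of weight zero. The weights are not
    normalised, so that conic combinations are covered too. *)
Lemma caratheodory_cost (R : realFieldType) (n m : nat) (A : set 'rV[R]_n)
    (k : 'rV[R]_n -> R) (l : 'I_(m + n.+1) -> R)
    (x : 'I_(m + n.+1) -> 'rV[R]_n) :
  (forall i, 0 <= l i) -> (forall i, A (x i)) ->
  exists (l' : 'I_n.+1 -> R) (x' : 'I_n.+1 -> 'rV[R]_n),
    [/\ forall i, 0 <= l' i, forall i, A (x' i),
        \sum_i l' i = \sum_i l i,
        \sum_i l' i *: x' i = \sum_i l i *: x i
      & \sum_i l' i * k (x' i) <= \sum_i l i * k (x i)].
Proof.
elim: m l x => [|m IHm] l x l_ge0 Ax; first by exists l, x.
have [||l1 [l1_ge0 sl1 sx1 sk1 [i l1i]]] :=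
  @caratheodory_step _ n (m + n.+1).+1 l x (k \o x).
- by rewrite addnS !ltnS leq_addl.
- exact: l_ge0.
have [||l2 [x2 [l2_ge0 Ax2 sl2 sx2 sk2]]] :=
  IHm (l1 \o lift i) (x \o lift i).
- by move=> j /=.
- by move=> j /=.
exists l2, x2; split => //.
- by rewrite sl2 -[RHS]sl1 (bigD1_ord i)//= l1i add0r.
- by rewrite sx2 -[RHS]sx1 (bigD1_ord i)//= l1i scale0r add0r.
- rewrite (le_trans sk2)// (le_trans _ sk1)// [leRHS](bigD1_ord i)//=.
  by rewrite l1i mul0r add0r.
Qed.

(** * Sublinear functions, Hahn-Banach and affine minorants *)

Section HahnBanach.
Context {R : realType} {n : nat}.
Implicit Types p q : 'rV[R]_n -> R.

Definition sublinear p :=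
  (forall u v, p (u + v) <= p u + p v) /\
  (forall (t : R) u, 0 <= t -> p (t *: u) = t * p u).

Lemma sublinear0 p : sublinear p -> p 0 = 0.
Proof. by move=> [_ pZ]; rewrite -[in LHS](scale0r 0) pZ// mul0r. Qed.

Lemma sublinear_ge p u : sublinear p -> - p (- u) <= p u.
Proof.
move=> psub; have [pD _] := psub; have := pD u (- u).
by rewrite subrr (sublinear0 psub); lra.
Qed.

(** Both sublinear functions constructed below are infima of this shape. Scaling by [t] gives one
    half of positive homogeneity, and scaling back by [t^-1] gives the other. *)
Lemma sublinear_inf (E : 'rV[R]_n -> set R) :
  (forall u, has_lbound (E u)) -> (forall u, E u !=set0) ->
  E 0 0 -> lbound (E 0) 0 ->
  (forall u v a b, E u a -> E v b -> exists2 c, E (u + v) c & c <= a + b) ->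
  (forall (t : R) u a, 0 < t -> E u a -> E (t *: u) (t * a)) ->
  sublinear (fun u => inf (E u)).
Proof.
move=> Elb Ene E00 E0_ge0 ED EZ; split.
- move=> u v; rewrite -lerBlDr; apply: lb_le_inf => // a Ea.
  rewrite lerBlDr -lerBlDl; apply: lb_le_inf => // b Eb.
  have [c Ec cab] := ED _ _ _ _ Ea Eb.
  by rewrite lerBlDl (le_trans _ cab)//; exact: ge_inf.
- have EZ_le (t : R) u : 0 < t -> inf (E (t *: u)) <= t * inf (E u).
    move=> t_gt0; rewrite mulrC -ler_pdivrMr//; apply: lb_le_inf => // a Ea.
    by rewrite ler_pdivrMr// mulrC; apply: ge_inf => //; exact: EZ.
  move=> t u; rewrite le_eqVlt => /predU1P[<-|t_gt0].
    rewrite scale0r mul0r; apply/eqP; rewrite eq_le ge_inf//=.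
    by apply: lb_le_inf => //; exists 0.
  apply/eqP; rewrite eq_le EZ_le//= -ler_pdivlMl//.
  have := EZ_le t^-1 (t *: u); rewrite invr_gt0 => /(_ t_gt0).
  by rewrite scalerA mulVf ?gt_eqF// scale1r.
Qed.

(* If a sublinear function satisfies [q (- e) <= - q e], it is linear along [e],
   and so is every sublinear minorant; hence the step can be iterated over a
   basis. *)
Lemma sublinear_linearize p (e : 'rV[R]_n) : sublinear p ->
  exists q : 'rV[R]_n -> R,
    [/\ sublinear q, forall u, q u <= p u & q (- e) <= - q e].
Proof.
move=> psub; have [pD pZ] := psub.
pose E (u : 'rV[R]_n) :=
  [set p (u + t *: e) - t * p e | t in [set t : R | 0 <= t]].
have E_lb u : lbound (E u) (- p (- u)).
  move=> _ [t /= t_ge0 <-].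
  have := pD (u + t *: e) (- u); rewrite addrAC subrr add0r pZ//; lra.
have Ep u : E u (p u) by exists 0 => //=; rewrite scale0r addr0 mul0r subr0.
have q_le u t : 0 <= t -> inf (E u) <= p (u + t *: e) - t * p e.
  by move=> t_ge0; apply: ge_inf; [exists (- p (- u))|exists t].
have q_le_p u : inf (E u) <= p u.
  by apply: ge_inf => //; exists (- p (- u)).
exists (fun u => inf (E u)); split => //.
- apply: sublinear_inf => [u|u||||].
  + by exists (- p (- u)).
  + by exists (p u).
  + by rewrite -[X in E _ X](sublinear0 psub).
  + by move=> _ [t /= t_ge0 <-]; rewrite add0r pZ// subrr.
  + move=> u v _ _ [s /= s_ge0 <-] [t /= t_ge0 <-].
    exists (p (u + v + (s + t) *: e) - (s + t) * p e).
      by exists (s + t) => //; exact: addr_ge0.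
    have := pD (u + s *: e) (v + t *: e).
    by rewrite addrACA -scalerDl; lra.
  + move=> t u _ t_gt0 [s /= s_ge0 <-]; exists (t * s).
      exact: mulr_ge0 (ltW _) _.
    by rewrite -scalerA -scalerDr pZ ?ltW// mulrBr mulrA.
(* The choice [t = 1] gives [q (- e) <= p 0 - p e = - p e], and [- p e <= - q e] because
   [q <= p]. *)
- have := q_le (- e) 1 ler01; have := q_le_p e.
  rewrite scale1r addNr (sublinear0 psub); lra.
Qed.

(** Linearising along every vector of the standard basis produces a minorant [q], whose values on
    the basis are the coefficients of the functional. *)
Lemma hahn_banach_rV p : sublinear p ->
  exists v : 'I_n -> R, forall u : 'rV[R]_n, \sum_j u 0 j * v j <= p u.
Proof.
move=> psub.
have [q [qsub q_le_p q_lin]] : exists q, [/\ sublinear q, forall u, q u <= p u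
    & forall j, q (- delta_mx 0 j) <= - q (delta_mx 0 j)].
  have [q [qsub q_le_p q_lin]] : exists q, [/\ sublinear q, forall u, q u <= p u
      & {in enum 'I_n, forall j, q (- delta_mx 0 j) <= - q (delta_mx 0 j)}].
    elim: (enum _) => [|j s [q [qsub q_le_p q_lin]]]; first by exists p; split.
    have [q' [q'sub q'_le_q q'_lin]] := sublinear_linearize (delta_mx 0 j) qsub.
    exists q'; split => // [u|i]; first exact: le_trans (q_le_p u).
    rewrite in_cons => /predU1P[->//|/q_lin qi].
    rewrite (le_trans (q'_le_q _))// (le_trans qi)// lerN2; exact: q'_le_q.
  by exists q; split => // j; apply: q_lin; rewrite mem_enum.
exists (fun j => q (delta_mx 0 j)) => u.
have [qD qZ] := qsub.
have q_sum (F : 'I_n -> 'rV[R]_n) : q (\sum_j F j) <= \sum_j q (F j).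
  elim/big_ind2 : _ => //; first by rewrite (sublinear0 qsub).
  by move=> a b a' b' ? ?; rewrite (le_trans (qD _ _))// lerD.
(* Passing through [- q (- u) <= q u] lets subadditivity, applied to the expansion of [- u], act in
   the needed direction. *)
apply: le_trans (q_le_p u); apply: le_trans (sublinear_ge u qsub).
rewrite lerNr -sumrN {1}(row_sum_delta u) -sumrN.
apply: le_trans (q_sum _) _; apply: ler_sum => j _.
(* Linearity along the basis vector enters when [0 <= u 0 j]; for a negative coordinate positive
   homogeneity suffices. *)
rewrite -scaleNr; have [uj|uj] := leP 0 (u 0 j).
  rewrite scaleNr -scalerN qZ// -mulrN ler_wpM2l//.
by rewrite qZ ?mulNr// oppr_ge0 ltW.
Qed.

(* The infimum defining the sublinear function below is penalised by [M] times
   the distance to [u], so that it is finite everywhere even when [z] is a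
   boundary point of [K]. *)
Lemma affine_minorant (K : set 'rV[R]_n) (z : 'rV[R]_n) (k : 'rV[R]_n -> R)
    (M : R) : 0 <= M -> K z ->
  (forall (x : 'I_n.+1 -> 'rV[R]_n) (l : 'I_n.+1 -> R),
     (forall i, K (x i)) -> convex_weights l ->
     0 <= \sum_i l i * k (x i) + M * `|barycenter l x - z|) ->
  exists v : 'I_n -> R, forall x, K x -> \sum_j (x - z) 0 j * v j <= k x.
Proof.
move=> M_ge0 Kz k_ge0.
(* Lists of pairs (weight, point) encode conic combinations of points of [K]; [mom] is the first
   moment about [z]. *)
pose cone (s : seq (R * 'rV[R]_n)) := forall a, a \in s -> 0 <= a.1 /\ K a.2.
pose cost (s : seq (R * 'rV[R]_n)) := \sum_(a <- s) a.1 * k a.2.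
pose mom (s : seq (R * 'rV[R]_n)) := \sum_(a <- s) a.1 *: (a.2 - z).
have cone_ge0 s : cone s -> 0 <= cost s + M * `|mom s|.
  (* Padding with copies of [z] of weight zero ensures at least [n + 1] points and changes neither
     [cost] nor [mom]. *)
  move=> cs; pose a i := nth (0, z) s i.
  have [a_ge0 Ka] : (forall i, 0 <= (a i).1) /\ forall i, K (a i).2.
    suff aP i : 0 <= (a i).1 /\ K (a i).2 by split => i; case: (aP i).
    have [lt_is|le_si] := ltnP i (size s); first exact/cs/mem_nth.
    by rewrite /a nth_default.
  have a_sum (V : zmodType) (F : R * 'rV[R]_n -> V) : F (0, z) = 0 ->
      \sum_(i < size s + n.+1) F (a i) = \sum_(b <- s) F b.
    move=> F0; rewrite big_split_ord/= [X in _ + X]big1 ?addr0.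
      by rewrite (big_nth (0, z)) big_mkord.
    by move=> i _; rewrite /a nth_default// leq_addr.
  have [l [x [l_ge0 Kx sl sx sk]]] := @caratheodory_cost _ n (size s) K k
    (fun i => (a i).1) (fun i => (a i).2) (fun i => a_ge0 i) (fun i => Ka i).
  have {}sk : \sum_i l i * k (x i) <= cost s.
    by rewrite (le_trans sk)// (a_sum _ (fun b => b.1 * k b.2))//= mul0r.
  have {sx} sx : \sum_i l i *: (x i - z) = mom s.
    rewrite /mom -(a_sum _ (fun b => b.1 *: (b.2 - z))) ?scale0r//=.
    under eq_bigr do rewrite scalerBr.
    under [RHS]eq_bigr do rewrite scalerBr.
    by rewrite !sumrB sx -!scaler_suml sl.
  (* Dividing by the total weight reduces to convex weights; if it is zero, every weight
     vanishes. *)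
  set W := \sum_i l i; have W_ge0 : 0 <= W by exact: sumr_ge0.
  have [W0|W_neq0] := eqVneq W 0.
    rewrite addr_ge0 ?mulr_ge0// (le_trans _ sk)// sumr_ge0// => i _.
    by rewrite (psumr_eq0P _ W0) ?mul0r.
  have W_gt0 : 0 < W by rewrite lt_def W_neq0.
  have := k_ge0 x (fun i => W^-1 * l i) Kx.
  have -> : barycenter (fun i => W^-1 * l i) x - z = W^-1 *: mom s.
    rewrite -sx scaler_sumr /barycenter.
    under [RHS]eq_bigr do rewrite scalerA scalerBr.
    by rewrite sumrB -scaler_suml -mulr_sumr mulVf// scale1r.
  have -> : \sum_i W^-1 * l i * k (x i) = W^-1 * \sum_i l i * k (x i).
    by rewrite mulr_sumr; apply: eq_bigr => i _; rewrite mulrA.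
  rewrite normrZ ger0_norm ?invr_ge0// mulrCA -mulrDr pmulr_rge0 ?invr_gt0//.
  move=> /(_ _)/le_trans; apply; last by rewrite lerD2r.
  split; first by move=> i; rewrite mulr_ge0 ?invr_ge0.
  by rewrite -mulr_sumr mulVf.
pose E (u : 'rV[R]_n) := [set cost s + M * `|u - mom s| | s in cone].
have E_lb u : lbound (E u) (- (M * `|u|)).
  move=> _ [s cs <-]; have := cone_ge0 s cs.
  have : M * `|mom s| <= M * `|u| + M * `|u - mom s|.
    by rewrite -mulrDr ler_wpM2l// -{1}(subKr u (mom s)) ler_normB.
  lra.
have E_nil u : E u (M * `|u|).
  by exists [::] => //; rewrite /cost /mom !big_nil add0r subr0.
have E00 : E 0 0 by have := E_nil 0; rewrite normr0 mulr0.
have [|v v_le] := @hahn_banach_rV (fun u => inf (E u)).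
  apply: sublinear_inf => //.
  - by move=> u; exists (- (M * `|u|)).
  - by move=> u; exists (M * `|u|).
  - by have := E_lb 0; rewrite normr0 mulr0 oppr0.
  - move=> u v _ _ [s cs <-] [t ct <-].
    exists (cost (s ++ t) + M * `|u + v - mom (s ++ t)|).
      exists (s ++ t) => // b; rewrite mem_cat => /orP[/cs//|/ct//].
    rewrite /cost /mom !big_cat/= -/(cost s) -/(cost t) -/(mom s) -/(mom t).
    rewrite opprD addrACA [leRHS]addrACA -mulrDr lerD2l ler_wpM2l//.
    exact: ler_normD.
  - move=> t u _ t_gt0 [s cs <-].
    exists [seq (t * b.1, b.2) | b <- s].
      move=> _ /mapP[b /cs[b1 b2] ->]; split => //=.
      by rewrite mulr_ge0// ltW.
    rewrite /cost /mom !big_map/= mulrDr mulr_sumr.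
    congr (_ + _); first by apply: eq_bigr => b _; rewrite mulrA.
    under eq_bigr do rewrite -scalerA.
    by rewrite -scaler_sumr -scalerBr normrZ gtr0_norm// mulrCA.
exists v => x Kx; apply: le_trans (v_le _) _; apply: ge_inf.
  by exists (- (M * `|x - z|)).
(* The point [x] with weight 1 has moment [x - z], so there is no penalty and the value is [k x]. *)
exists [:: (1, x)].
  by move=> b; rewrite inE => /eqP->.
by rewrite /cost /mom !big_seq1/= scale1r subrr normr0 mulr0 addr0 mul1r.
Qed.

End HahnBanach.

(** * Convex combinations, compactness and uniform continuity *)

Lemma convex_set_sum (R : realType) (n N : nat) (K : set 'rV[R]_n)
    (l : 'I_N.+1 -> R) (x : 'I_N.+1 -> 'rV[R]_n) :
  convex_set (K : set (convex_lmodType 'rV[R]_n)) ->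
  (forall i, K (x i)) -> (forall i, 0 <= l i) -> \sum_i l i = 1 ->
  K (\sum_i l i *: x i).
Proof.
move=> cK; elim: N l x => [|N IHN] l x Kx l_ge0 l1.
  by move: l1; rewrite !big_ord1 => ->; rewrite scale1r.
rewrite big_ord_recl in l1; rewrite big_ord_recl.
set W := \sum_(i < N.+1) l (lift ord0 i) in l1.
have W_ge0 : 0 <= W by exact: sumr_ge0.
have [W0|W_neq0] := eqVneq W 0.
  rewrite big1 => [|i _]; last by rewrite (psumr_eq0P _ W0) ?scale0r.
  by rewrite addr0 -[l ord0](addr0) -W0 l1 scale1r.
have W_gt0 : 0 < W by rewrite lt_def W_neq0.
have Ky : K (\sum_i (W^-1 * l (lift ord0 i)) *: x (lift ord0 i)).
  apply: (IHN (fun i => W^-1 * l (lift ord0 i))) => //.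
    by move=> i; rewrite mulr_ge0 ?invr_ge0.
  by rewrite -mulr_sumr mulVf.
have l0_le1 : l ord0 <= 1 by rewrite -l1 lerDl.
have := cK _ _ (Itv01 (l_ge0 ord0) l0_le1) (mem_set (Kx ord0)) (mem_set Ky).
move/set_mem; congr K; congr (_ + _) => /=.
rewrite /unstable.onem -l1 addrAC subrr add0r scaler_sumr.
by apply: eq_bigr => i _; rewrite scalerA mulrA mulfV// mul1r.
Qed.

Lemma compact_within_bounded (R : realType) (T : topologicalType) (A : set T)
    (f : T -> R) :
  compact A -> {within A, continuous f} -> [bounded f x | x in A].
Proof.
move=> cA cf; have [M [Mr fM]] := compact_bounded (continuous_compact cf cA).
by exists M; split => // r /fM fr x Ax; apply: fr; exists x.
Qed.

(** A tube argument: continuity at each [(z, x)] gives a product neighbourhood, and compactness of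
    [K] makes the neighbourhood of [z] independent of [x]. *)
Lemma near_compact_uniform (R : realType) (S T : topologicalType) (A : set S)
    (K : set T) (f : S -> T -> R) (z : S) (e : R) :
  compact K -> {within A `*` K, continuous (fun p => f p.1 p.2)} ->
  A z -> 0 < e ->
  \forall y \near within A (nbhs z), forall x, K x -> `|f y x - f z x| < e.
Proof.
move=> cK cf Az e_gt0.
move/compact_near_coveringP/near_covering_withinP : cK; apply => x Kx.
have /subspace_continuousP/(_ (z, x) (conj Az Kx))/cvgr_dist_lt := cf.
have e2_gt0 : 0 < e / 2 by lra.
move=> /(_ _ e2_gt0)[[U V] /= [Uz Vx] UV].
exists (V, [set y | A y /\ U y]) => /=.
  by split => //; apply: filterS Uz => y Uy Ay.
move=> [x' y] /= [Vx' [Ay Uy]] Kx'.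
have := UV (y, x') (conj Uy Vx') (conj Ay Kx').
have := UV (z, x') (conj (nbhs_singleton Uz) Vx') (conj Az Kx').
rewrite /from_subspace /= !ltr_norml => /andP[? ?] /andP[? ?].
by apply/andP; split; lra.
Qed.

(** * Integrability of continuous functions on [K], and the two copies of [K] *)

Section BorelRV.
Context {R : realType} {n : nat}.
Implicit Types (K : set 'rV[R]_n) (f g : 'rV[R]_n -> R).

Lemma compact_measurable_rV K :
  compact K -> measurable (K : set (borel_rV R n)).
Proof.
move=> /(compact_closed (@norm_hausdorff _ _)) cK.
rewrite -(setCK K); apply: measurableC; apply: sub_sigma_algebra.
exact: closed_openC.
Qed.

Lemma within_continuous_measurable_rV K f : compact K ->
  {within K, continuous f} -> measurable_fun (K : set (borel_rV R n)) f.
Proof.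
move=> cK /continuousP cf.
apply: (measurability _ (measurable_realfun.RGenOpens.measurableE R)).
move=> _ [_ [a [b ->] <-]].
have /open_subspaceP[V oV VK] :
    open (f @^-1` `]a, b[ : set (subspace K)) by exact/cf/interval_open.
rewrite setIC -VK; apply: measurableI; last exact: compact_measurable_rV.
exact: sub_sigma_algebra.
Qed.

Lemma within_continuous_integrable_rV K f (mu : probability (borel_rV R n) R) :
  compact K -> {within K, continuous f} -> mu.-integrable K (EFin \o f).
Proof.
move=> cK cf; apply: measurable_bounded_integrable.
- exact: compact_measurable_rV.
- rewrite (le_lt_trans (probability_le1 _ _)) ?ltry//.
  exact: compact_measurable_rV.
- exact: within_continuous_measurable_rV.
- exact: compact_within_bounded.
Qed.

Lemma bounded_continuous_copy K (g : {_ : bool & 'rV[R]_n} -> R) b :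
  bounded_continuous (disjoint_double K) g ->
  {within K, continuous (fun x => g (existT _ b x))}.
Proof.
move=> [/subspace_continuousP cg _]; apply/subspace_continuousP => x Kx U Ugx.
exact: (cg (existT _ b x) Kx U Ugx).
Qed.

Lemma bounded_continuous_double K f : bounded_continuous K f ->
  bounded_continuous (disjoint_double K) (fun p => f (projT2 p)).
Proof.
move=> [/subspace_continuousP cf [M [Mr bf]]]; split.
  apply/subspace_continuousP => -[b x] Kx U Ufx; exact: (cf x Kx U Ufx).
by exists M; split => // r /bf fr -[b x] Kx; exact: (fr x Kx).
Qed.

End BorelRV.

Lemma within_continuous_slice (R S T : topologicalType) (A : set R) (B : set S)
    (f : R -> S -> T) (a : R) :
  {within A `*` B, continuous (fun p => f p.1 p.2)} -> A a ->
  {within B, continuous (f a)}.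
Proof.
move=> /subspace_continuousP cf Aa; apply/subspace_continuousP => b Bb W Wab.
have [[U V] /= [Ua Vb] UV] := cf (a, b) (conj Aa Bb) W Wab.
apply: filterS Vb => y Vy By.
exact: (UV (a, y) (conj (nbhs_singleton Ua) Vy) (conj Aa By)).
Qed.

(** * Minorants in [B1] of elements of [B2] *)

Section Transport.
Context {R : realType} {n : nat} {K : set 'rV[R]_n}.
Context {c : 'rV[R]_n -> 'rV[R]_n -> R}.

Lemma affine_continuous (z : 'rV[R]_n) (v : 'I_n -> R) :
  continuous (fun x : 'rV[R]_n => \sum_j (x - z) 0 j * v j).
Proof.
have cj j : continuous (fun x : 'rV[R]_n => (x 0 j - z 0 j) * v j : R).
  move=> x.
  apply: (@cvgM _ _ (nbhs x) _ (fun y : 'rV[R]_n => y 0 j - z 0 j)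
    (fun=> v j)); last exact: cvg_cst.
  by apply: (@cvgB _ _ _ (nbhs x)); [exact: coord_continuous|exact: cvg_cst].
apply: continuous_big => [|j _]; first exact: add_continuous.
rewrite (_ : (fun x => _) = (fun x : 'rV[R]_n => (x 0 j - z 0 j) * v j)).
  exact: cj.
by apply/funext => x; rewrite !mxE.
Qed.

Lemma weighted_sum_affine (l : 'I_n.+1 -> R) (x : 'I_n.+1 -> 'rV[R]_n)
    (z : 'rV[R]_n) (v : 'I_n -> R) (b : R) : convex_weights l ->
  \sum_i l i * (b + \sum_j (x i - z) 0 j * v j) =
  b + \sum_j (barycenter l x - z) 0 j * v j.
Proof.
move=> [_ l1].
have -> : barycenter l x - z = \sum_i l i *: (x i - z).
  under eq_bigr do rewrite scalerBr.
  by rewrite sumrB -scaler_suml l1 scale1r.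
under eq_bigr do rewrite mulrDr.
rewrite big_split/= -mulr_suml l1 mul1r; congr (_ + _).
under [RHS]eq_bigr do rewrite summxE mulr_suml.
rewrite exchange_big/=; apply: eq_bigr => i _.
by rewrite mulr_sumr; apply: eq_bigr => j _; rewrite [in RHS]mxE mulrA.
Qed.

(** At the barycenter the maximum equals one of the two functions, whose own inequality applies; the
    average subtracted there only grows when that function is replaced by the maximum. *)
Lemma B1_max f g : B1 K c f -> B1 K c g -> compact K ->
  B1 K c (fun x => Num.max (f x) (g x)).
Proof.
move=> [[cf _] hf] [[cg _] hg] cK.
have cfg : {within K, continuous (fun x => Num.max (f x) (g x))}.
  move=> x; apply: continuous_max; [exact: cf|exact: cg].
split; first by split => //; exact: compact_within_bounded.
move=> x l Kx lw; have [l_ge0 l1] := lw.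
have le_sum h : (forall y, h y <= Num.max (f y) (g y)) ->
    \sum_i l i * h (x i) <= \sum_i l i * Num.max (f (x i)) (g (x i)).
  by move=> hm; apply: ler_sum => i _; exact: ler_wpM2l.
have := hf x l Kx lw; have := hg x l Kx lw.
have := le_sum f (fun y => ltac:(by rewrite le_max lexx)).
have := le_sum g (fun y => ltac:(by rewrite le_max lexx orbT)).
case: (leP (f (barycenter l x)) (g (barycenter l x))) => _; lra.
Qed.

Context (hK : convex_body K).
Context (hc_cont : {within K `*` K, continuous (fun p => c p.1 p.2)}).
Context (hc_mti : martingale_triangle K c).
Context (hc_diag : forall x, K x -> c x x = 0).

(* Affine terms cancel in the defining inequality of [B1]; what remains is the
   martingale triangle inequality. *)
Lemma B1_affine_sub_cost (z : 'rV[R]_n) (v : 'I_n -> R) (b : R) : K z ->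
  B1 K c (fun x => b + \sum_j (x - z) 0 j * v j - c z x).
Proof.
move=> Kz; have [_ cK _] := hK; split.
  have cphi : {within K,
      continuous (fun x => b + \sum_j (x - z) 0 j * v j - c z x)}.
    have ca : {within K, continuous (fun x => \sum_j (x - z) 0 j * v j)}.
      by apply: continuous_subspaceT; exact: affine_continuous.
    have cc := within_continuous_slice hc_cont Kz.
    move=> x; apply: cvgB; last exact: cc.
    by apply: cvgD; [exact: cvg_cst|exact: ca].
  by split => //; exact: compact_within_bounded.
move=> x l Kx lw.
have -> : \sum_i l i * (b + \sum_j (x i - z) 0 j * v j - c z (x i)) =
    b + \sum_j (barycenter l x - z) 0 j * v j - \sum_i l i * c z (x i).
  rewrite -(weighted_sum_affine x z v b lw) -sumrB.
  by apply: eq_bigr => i _; rewrite mulrBr.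
have := hc_mti Kz Kx lw; lra.
Qed.

Lemma B2_minorant_at (g : {_ : bool & 'rV[R]_n} -> R) (z : 'rV[R]_n) (e : R) :
  B2 K c g -> K z -> 0 < e ->
  exists f, [/\ B1 K c f, forall x, K x -> f x <= snd_copy g x
              & fst_copy g z - e <= f z].
Proof.
move=> [bcg hg] Kz e_gt0; have [convK cK _] := hK.
have cg1 := bounded_continuous_copy (b := false) bcg.
have cg2 := bounded_continuous_copy (b := true) bcg.
have cc := within_continuous_slice hc_cont Kz.
(* An affine minorant of [k] vanishing at [z], raised by [fst_copy g z - e], lies below
   [snd_copy g + c z]. The slack [e] is split evenly between the variations of [fst_copy g] and of
   [c] near [z]. *)
pose k x := snd_copy g x + c z x - fst_copy g z + e.
have [B B_gt0 kB] : exists2 B, 0 < B & forall x, K x -> - B <= k x.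
  have ck : {within K, continuous k}.
    move=> x; apply: cvgD; last exact: cvg_cst.
    apply: cvgB; last exact: cvg_cst.
    by apply: cvgD; [exact: cg2|exact: cc].
  have /pinfty_ex_gt0[B B_gt0 kB] := compact_within_bounded cK ck.
  by exists B => // x /kB /=; rewrite ler_norml => /andP[].
have e2_gt0 : 0 < e / 2 by lra.
have [d d_gt0 dP] : exists2 d, 0 < d & forall y, K y -> `|y - z| < d ->
    `|fst_copy g y - fst_copy g z| < e / 2 /\
    forall x, K x -> `|c y x - c z x| < e / 2.
  have near1 := near_compact_uniform cK hc_cont Kz e2_gt0.
  move/subspace_continuousP/(_ z Kz)/cvgr_distC_lt/(_ _ e2_gt0) : cg1 => near2.
  have : \forall y \near z, K y -> `|fst_copy g y - fst_copy g z| < e / 2 /\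
      forall x, K x -> `|c y x - c z x| < e / 2.
    exact: filterI near2 near1.
  move=> /nbhs_normP[d /= d_gt0 dP].
  by exists d => // y Ky yz; apply: (dP y) => //=; rewrite distrC.
(* With slope [B / d], the penalty reaches [B] at distance [d] from [z] and so outweighs the lower
   bound [- B] of [k]. *)
have M_ge0 : 0 <= B / d by rewrite divr_ge0// ltW.
(* Combinations with barycenter [y] near [z] are controlled by the condition B2
   at [y] and continuity, the others by the penalty term. *)
have [x l Kx lw|v v_le] := affine_minorant M_ge0 Kz (k := k).
  have [l_ge0 l1] := lw.
  have Ky : K (barycenter l x) by exact: convex_set_sum.
  have [yz|dy] := ltP `|barycenter l x - z| d; last first.
    have : - B <= \sum_i l i * k (x i).
      rewrite -[- B]mul1r -l1 mulr_suml; apply: ler_sum => i _.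
      by rewrite ler_wpM2l// kB.
    have : B <= B / d * `|barycenter l x - z|.
      by rewrite -ler_pdivrMl ?divr_gt0// invf_div divfK ?gt_eqF.
    lra.
  have [g1y cy] := dP _ Ky yz.
  apply: addr_ge0; last exact: mulr_ge0.
  have : \sum_i l i * (snd_copy g (x i) + c (barycenter l x) (x i)
      - fst_copy g z + e / 2) <= \sum_i l i * k (x i).
    apply: ler_sum => i _; rewrite ler_wpM2l// /k.
    have := cy _ (Kx i); rewrite ltr_norml => /andP[? ?]; lra.
  apply: le_trans.
  have -> : \sum_i l i * (snd_copy g (x i) + c (barycenter l x) (x i)
      - fst_copy g z + e / 2) = \sum_i l i * snd_copy g (x i)
      + \sum_i l i * c (barycenter l x) (x i) + (e / 2 - fst_copy g z).
    rewrite -[e / 2 - _]mul1r -l1 mulr_suml -!big_split/=.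
    by apply: eq_bigr => i _; ring.
  have := hg x l Kx lw; move: g1y; rewrite ltr_norml => /andP[g1y _]; lra.
exists (fun x => fst_copy g z - e + \sum_j (x - z) 0 j * v j - c z x).
split.
- exact: B1_affine_sub_cost.
- move=> x Kx; have := v_le x Kx; rewrite /k; lra.
(* At [z] both the affine term and [c z z] vanish, leaving [fst_copy g z - e]. *)
- rewrite hc_diag// big1 => [|j _]; last by rewrite subrr mxE mul0r.
  by rewrite addr0 subr0.
Qed.

Lemma B2_minorant (g : {_ : bool & 'rV[R]_n} -> R) (e : R) :
  B2 K c g -> 0 < e ->
  exists f, [/\ B1 K c f, forall x, K x -> f x <= snd_copy g x
              & forall x, K x -> fst_copy g x - e <= f x].
Proof.
move=> Bg e_gt0; have [_ cK [z0 /nbhs_singleton Kz0]] := hK.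
have e2_gt0 : 0 < e / 2 by lra.
have /choice[f fP] : forall z, exists f, K z ->
    [/\ B1 K c f, forall x, K x -> f x <= snd_copy g x
      & fst_copy g z - e / 2 <= f z].
  move=> z; have [Kz|nKz] := pselect (K z); last by exists (fun=> 0).
  by have [f] := B2_minorant_at Bg Kz e2_gt0; exists f.
(* The inequality is imposed only on [K], while [U z] is open in the ambient space, as the covering
   form of compactness demands. *)
pose U z := [set x | K x -> fst_copy g x - e < f z x]°.
have KU : K `<=` cover K U.
  move=> z Kz; exists z => //.
  have [[[cf _] _] _ gf] := fP z Kz.
  have [bcg _] := Bg; have cg1 := bounded_continuous_copy (b := false) bcg.
  (* The error [e / 2] at [z] plus [e / 4] for each of the variations of [fst_copy g] and [f z] adds
     up to [e]. *)
  have e4_gt0 : 0 < e / 4 by lra.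
  move/subspace_continuousP/(_ z Kz)/cvgr_distC_lt/(_ _ e4_gt0) : cg1 => near1.
  move/subspace_continuousP/(_ z Kz)/cvgr_distC_lt/(_ _ e4_gt0) : cf => near2.
  rewrite /U /interior/=.
  apply: filterS (filterI near1 near2) => x [].
  rewrite /from_subspace/= !ltr_norml => /andP[? ?] /andP[? ?].
  move: gf; rewrite /fst_copy/=; lra.
have [D DK KD] : finite_subset_cover K U K.
  by move: cK; rewrite compact_cover; apply => // z _; exact: open_interior.
(* The maximum over the finite cover is built by induction, starting from [f z0] with [z0] an
   interior point of [K]. *)
have [h [Bh hg hf]] : exists h, [/\ B1 K c h,
    forall x, K x -> h x <= snd_copy g x
    & forall z, z \in finmap.enum_fset D -> forall x, f z x <= h x].
  have : {subset finmap.enum_fset D <= K} by exact: DK.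
  elim: (finmap.enum_fset D) => [_|z s IHs sK].
    by have [Bf fg _] := fP z0 Kz0; exists (f z0).
  have [|h [Bh hg hf]] := IHs.
    by move=> y ys; apply: sK; rewrite in_cons ys orbT.
  have /set_mem Kz : z \in K by apply: sK; rewrite mem_head.
  have [Bf fg _] := fP z Kz.
  exists (fun x => Num.max (f z x) (h x)); split.
  - exact: B1_max.
  - by move=> x Kx; rewrite ge_max fg ?hg.
  - move=> y; rewrite in_cons => /predU1P[-> x|/hf hy x].
      by rewrite le_max lexx.
    by rewrite le_max hy orbT.
exists h; split => // x Kx.
have [z /= zD /interior_subset/(_ Kx)/ltW gf] := KD x Kx.
by rewrite (le_trans gf)// hf.
Qed.

End Transport.

(** * Equality of the two suprema *)

Theorem theorem5p3 (R : realType) (n : nat) (K : set 'rV[R]_n)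
    (c : 'rV[R]_n -> 'rV[R]_n -> R)
    (hK : convex_body K)
    (hc_cont : {within K `*` K, continuous (fun p => c p.1 p.2)})
    (hc_mti : martingale_triangle K c)
    (hc_diag : forall x, K x -> c x x = 0)
    (mu nu : probability (borel_rV R n) R)
    (hmu : mu K = 1%:E) (hnu : nu K = 1%:E)
    (hmunu : convex_order K mu nu) :
  ereal_sup [set (\int[mu]_(x in K) f x - \int[nu]_(x in K) f x)%:E
            | f in B1 K c] =
  ereal_sup [set (\int[mu]_(x in K) fst_copy g x
                  - \int[nu]_(x in K) snd_copy g x)%:E
            | g in B2 K c].
Proof.
have [_ cK _] := hK; have mK := compact_measurable_rV cK.
apply/eqP; rewrite eq_le; apply/andP; split.
  apply: ub_ereal_sup => _ [f [bcf hf] <-]; apply: ereal_sup_ubound.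
  exists (fun p => f (projT2 p)) => //.
  by split => //; exact: bounded_continuous_double.
apply: ub_ereal_sup => _ [g Bg <-]; apply/lee_addgt0Pr => e e_gt0.
have [f [Bf fg gf]] := B2_minorant hK hc_cont hc_mti hc_diag Bg e_gt0.
have [[cf _] _] := Bf; have [bcg _] := Bg.
have int P := within_continuous_integrable_rV P cK.
have cg1 := bounded_continuous_copy (b := false) bcg.
have cg2 := bounded_continuous_copy (b := true) bcg.
(* On [K], [fst_copy g - e <= f] is integrated against [mu] and [f <= snd_copy g] against [nu]; as
   [mu K = 1], the total loss is exactly [e]. *)
apply: (@le_trans _ _
  ((\int[mu]_(x in K) f x - \int[nu]_(x in K) f x)%:E + e%:E)%E); last first.
  by rewrite leeD2r// ereal_sup_ubound//; exists f.
rewrite -EFinD lee_fin.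
have ce : {within K, continuous (fun=> e)} by move=> x; exact: cvg_cst.
have : \int[nu]_(x in K) f x <= \int[nu]_(x in K) snd_copy g x.
  by apply: le_Rintegral => //; exact: int.
have : \int[mu]_(x in K) (fst_copy g x - e) <= \int[mu]_(x in K) f x.
  apply: le_Rintegral => //; apply: int => //.
  by move=> x; apply: cvgB; [exact: cg1|exact: ce].
rewrite RintegralB//; [|exact: int|exact: int].
rewrite Rintegral_cst// [X in fine X]hmu mulr1; lra.
Qed.
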